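(* Let $Y_1,\dots,Y_n$ be independent real random variables with joint law $P$ and respective c.d.f.'s $F_1,\dots,F_n$, let $\alpha\in(0,1)$ and $k\in[0,n-1]$. Consider any family of c.d.f.'s $(F_{0,\vartheta})_{\vartheta\in\Theta}$. Then the test rejecting the null hypothesis $H_0''$: ''$\exists\vartheta\in\Theta: F_{0,\vartheta}\in\mathcal F_{0,k}(P)$'' whenever $F_{0,\vartheta}\notin\mathcal F_{1-\alpha}(Y)$ for all $\vartheta\in\Theta$, that is, whenever the confidence region contains no null distribution of the family, is of level $\alpha$ (i.e. if $H_0''$ holds then $\mathbb P(\forall\vartheta\in\Theta,\ F_{0,\vartheta}\notin\mathcal F_{1-\alpha}(Y))\le\alpha$).
   Context: Definitions. $\mathcal F_{0,k}(P)=\{F_0\text{ c.d.f. on }\mathbb R:\ |\{i\in\{1,\dots,n\}: F_i=F_0\}|\ge n-k\}$. Let $Y_{(1)}\le\dots\le Y_{(n)}$ be the order statistics of $(Y_i)_{1\le i\le n}$, with $Y_{(0)}=-\infty$, $Y_{(n+1)}=+\infty$; for a c.d.f. $F_0$, $F_0(y^-)=\lim_{x\to y^-}F_0(x)$ (with $F_0(-\infty)=0$, $F_0(+\infty^-)=1$). Write $x\vee y=\max(x,y)$, $x\wedge y=\min(x,y)$. Let $c_{n,\alpha}=\{-(1-k/n)\log(\alpha/2)/(2n)\}^{1/2}$ and, for $j\in\{0,\dots,n\}$, $$\widehat a_n(j;F_0)=0\vee\frac{\max_{0\le\ell\le j}\{\ell/n-(1-k/n)F_0(Y_{(\ell)})\}-c_{n,\alpha}}{k/n},$$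 $$\widehat b_n(j;F_0)=1\wedge\frac{\min_{j\le\ell\le n}\{\ell/n-(1-k/n)F_0(Y_{(\ell+1)}^-)\}+c_{n,\alpha}}{k/n},$$ $$\mathcal F_{1-\alpha}(Y)=\{F_0\text{ c.d.f.}:\ \forall j\in\{0,\dots,n\},\ \widehat a_n(j;F_0)\le\widehat b_n(j;F_0)\}.$$ When $k=0$, quotients by $k/n=0$ are understood as $+\infty$, $-\infty$ or $0$ according to whether the numerator is positive, negative or zero. *)

(* Defs.v *)
From HB Require Import structures.
From mathcomp Require Import all_boot all_order all_algebra.
From mathcomp Require Import all_classical all_reals all_analysis.

Set Implicit Arguments.
Unset Strict Implicit.
Unset Printing Implicit Defensive.

Import Order.TTheory GRing.Theory Num.Theory.
Import numFieldNormedType.Exports.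

Local Open Scope classical_set_scope.
Local Open Scope ring_scope.

(* A bundled cumulative distribution function on R: nondecreasing,
   right-continuous, with limits 0 at -oo and 1 at +oo. *)
Notation cdfType R := (cumulativeBounded (0 : R) (1 : R)).

Definition mutually_independent d (T : measurableType d) (R : realType)
    (P : probability T R) (I : finType) (Y : I -> {RV P >-> R}) : Prop :=
  forall (J : {set I}) (B : I -> set R),
    (forall i, i \in J -> measurable (B i)) ->
    P (\bigcap_(i in [set` J]) (Y i @^-1` B i)) =
    (\prod_(i in J) P (Y i @^-1` B i))%E.

Definition null_distributions d (T : measurableType d) (R : realType)
    (P : probability T R) (n k : nat) (Y : 'I_n -> {RV P >-> R}) :
    set (cdfType R) :=
  [set F0 | (n - k <=
     #|[set i : 'I_n | `[< forall x : R, cdf (Y i) x = (F0 x)%:E >]]|)%N].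

Section confidence_region.
Context {R : realType}.
Local Open Scope ereal_scope.

(* [order_stat y l] is the l-th smallest value for 1 <= l <= n, -oo for l = 0,
   and +oo (the default value of [nth]) for l = n.+1. *)
Definition order_stat (n : nat) (y : 'I_n -> R) (l : nat) : \bar R :=
  nth +oo (-oo :: [seq r%:E | r <- sort <=%R (codom y)]) l.

Definition cdf_at (F0 : cdfType R) (x : \bar R) : R :=
  match x with r%:E => F0 r | +oo => 1%R | -oo => 0%R end.

Definition cdf_left_at (F0 : cdfType R) (x : \bar R) : R :=
  match x with
  | r%:E => lim (F0 t @[t --> r^'-])
  | +oo => 1%R
  | -oo => 0%R
  end.

Definition dkw_radius (n k : nat) (alpha : R) : R :=
  Num.sqrt (- (1 - k%:R / n%:R) * ln (alpha / 2) / (2 * n%:R)).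

(* The quotients by k/n are taken in \bar R, where (0%:E)^-1 = +oo and x * +oo
   is +oo, -oo or 0 according to the sign of x; this is the wanted convention
   for k = 0. *)
Definition a_hat (n k : nat) (alpha : R) (y : 'I_n -> R) (F0 : cdfType R)
    (j : nat) : \bar R :=
  maxe 0
    ((\big[maxe/-oo]_(0 <= l < j.+1)
        (l%:R / n%:R - (1 - k%:R / n%:R) * cdf_at F0 (order_stat y l))%:E
      - (dkw_radius n k alpha)%:E) / (k%:R / n%:R)%:E).

Definition b_hat (n k : nat) (alpha : R) (y : 'I_n -> R) (F0 : cdfType R)
    (j : nat) : \bar R :=
  mine 1
    ((\big[mine/+oo]_(j <= l < n.+1)
        (l%:R / n%:R
           - (1 - k%:R / n%:R) * cdf_left_at F0 (order_stat y l.+1))%:E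
      + (dkw_radius n k alpha)%:E) / (k%:R / n%:R)%:E).

Definition confidence_region (n k : nat) (alpha : R) (y : 'I_n -> R) :
    set (cdfType R) :=
  [set F0 | forall j : nat, (j <= n)%N ->
     a_hat k alpha y F0 j <= b_hat k alpha y F0 j].

End confidence_region.

(* Main.v *)
Require Import Defs.
From HB Require Import structures.
From mathcomp Require Import all_boot all_order all_algebra.
From mathcomp Require Import all_classical all_reals all_analysis.
From mathcomp Require Import ring lra zify.

Set Implicit Arguments.
Unset Strict Implicit.
Unset Printing Implicit Defensive.

Import Order.TTheory GRing.Theory Num.Theory.
Import numFieldNormedType.Exports.

Local Open Scope classical_set_scope.
Local Open Scope ring_scope.

(** Let F be a null distribution in the family and J a set of m = n - k indices
    whose observations have c.d.f. F.  It suffices that the region contains F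
    with probability at least 1 - alpha.  Choose eps with
    m * eps = n * c_(n,alpha), so that 2 exp(- 2 m eps^2) = alpha.

    If the empirical c.d.f. of the observations in J stays within eps of F, then
    F is in the region: the counting function of the k other observations is
    nondecreasing and separates the lower envelope from the upper one
    ([confidence_region_of_count_bounds]).  The statement is therefore the
    Dvoretzky-Kiefer-Wolfowitz inequality with Massart's constant, for m
    independent observations and an arbitrary F ([dkw_two_sided]).

    For one tail, let C_x be a decreasing chain of half-lines, t_x the
    probability of C_x and N_x the number of observations of J in it.  As C_x
    shrinks, (1 + theta / t_x)^(N_x) is a martingale with initial value
    (1 + theta)^m, and the maximal inequality ([hitting_bound]) bounds the
    probability that N_x >= m (t_x + eps) for some x by the supremum over t of
    (1 + theta)^m / (1 + theta / t)^(m (t + eps)).  The point is that a single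
    theta makes this at most exp(- 2 m eps^2), at all levels t simultaneously
    ([sharp_tilt_exists]).  It is found at a saddle point: q is a critical point
    of the relative entropy between Bernoulli laws of parameters q + eps and q,
    theta is the optimal Chernoff tilt for the level q, and q turns out to be
    the worst level for this theta.  The exponent there is the relative entropy
    itself, hence at least 2 eps^2 by Pinsker's inequality.  The bound is free
    of any prefactor and holds for every eps > 0; two tails give the factor 2
    which c_(n,alpha) accounts for. *)

(** * Inequalities for the logarithm *)

Lemma le_of_deriv_ge0 (R : realType) (f df : R -> R) (a b : R) :
  a <= b -> (forall x, a <= x <= b -> is_derive x 1 f (df x)) ->
  (forall x, a <= x <= b -> 0 <= df x) -> f a <= f b.
Proof.
move=> ab fd df0.
have fd' (x : R) : x \in `]a, b[ -> is_derive x 1 f (df x).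
  by rewrite in_itv /= => /andP[/ltW ax /ltW xb]; apply: fd; rewrite ax.
have cf : {within `[a, b], continuous f}.
  apply: derivable_within_continuous => x; rewrite in_itv /= => xab.
  by have [] := fd x xab.
have [c cab eq] := MVT_segment ab fd' cf.
by rewrite -subr_ge0 eq mulr_ge0 ?subr_ge0 ?df0.
Qed.

Lemma le_ln_sub1 (R : realType) (x : R) : 0 < x -> ln x <= x - 1.
Proof.
move=> x0; have := @le_ln1Dx R (x - 1).
by rewrite [1 + _]addrC subrK; apply; lra.
Qed.

Lemma ln_ge_ratio (R : realType) (x : R) :
  1 <= x -> 2 * (x - 1) <= (x + 1) * ln x.
Proof.
move=> x1.
pose f : R -> R := (id + cst 1) * @ln R - cst 2 * (id - cst 1).
suff : f 1 <= f x by rewrite /f ?fctE ln1 subrr !mulr0 subrr subr_ge0.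
apply: (@le_of_deriv_ge0 _ f (fun y => ln y + y^-1 - 1))
  => [//|y /andP[y1 _]|y /andP[y1 _]];
  have y0 : 0 < y by lra.
  have := is_derive1_ln y0 => dln; rewrite /f; apply: is_derive_eq.
  rewrite /GRing.scale /= ?fctE; field; lra.
have yV0 : 0 < y^-1 by rewrite invr_gt0.
have := le_ln_sub1 yV0; rewrite lnV ?posrE//; lra.
Qed.

Lemma ln_le_half_diff (R : realType) (x : R) :
  1 <= x -> ln x <= (x - x^-1) / 2.
Proof.
move=> x1.
pose f : R -> R := cst (1 / 2) * (id - (fun y => (id y)^-1)) - @ln R.
suff : f 1 <= f x by rewrite /f ?fctE /= ln1 invr1; lra.
apply: (@le_of_deriv_ge0 _ f (fun y => (1 - y^-1) ^+ 2 / 2))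
  => [//|y /andP[y1 _]|y /andP[y1 _]];
  have y0 : 0 < y by lra.
  have := is_derive1_ln y0 => dln.
  have := is_deriveV (lt0r_neq0 y0) (is_derive_id y 1) => dV.
  rewrite /f; apply: is_derive_eq.
  rewrite /GRing.scale /= ?fctE /=; field; lra.
by rewrite divr_ge0 ?sqr_ge0.
Qed.

(** Pinsker's inequality for Bernoulli laws.  As a function of q the difference
    of the two sides has derivative - (p - q) (1 - 2 q)^2 / (q (1 - q)), and it
    vanishes at q = p. *)
Lemma pinsker_bernoulli (R : realType) (p q : R) : 0 < q -> q <= p -> p < 1 ->
  2 * (p - q) ^+ 2 <= p * (ln p - ln q) + (1 - p) * (ln (1 - p) - ln (1 - q)).
Proof.
move=> q0 qp p1.
pose g : R -> R := cst p - id.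
pose f : R -> R :=
  p *: @ln R + (1 - p) *: (@ln R \o (cst 1 - id)) + 2 *: (g * g).
suff : f q <= f p.
  by rewrite /f /g /GRing.scale /= ?fctE /= /GRing.scale /=; lra.
pose df (x : R) := (p - x) * (1 - 2 * x) ^+ 2 / (x * (1 - x)).
have bounds x : q <= x <= p -> 0 < x /\ 0 < 1 - x.
  by move=> /andP[qx xp]; rewrite (lt_le_trans q0 qx) subr_gt0 (le_lt_trans xp).
have fE x : q <= x <= p -> is_derive x 1 f (df x).
  move=> /bounds[x0 x1].
  have dln := is_derive1_ln x0.
  have dln1 := is_derive1_ln (x1 : 0 < (cst 1 - id) x).
  have dc : is_derive x (1:R) (@ln R \o (cst 1 - id)) (- (1 - x)^-1).
    by apply: is_derive_eq; rewrite /GRing.scale /= ?fctE sub0r mulrN1.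
  have dg : is_derive x (1:R) g (-1).
    by rewrite /g; apply: is_derive_eq; rewrite sub0r.
  apply: (is_derive_eq (is_deriveD
    (is_deriveD (is_deriveZ p dln) (is_deriveZ (1 - p) dc))
    (is_deriveZ 2 (is_deriveM dg dg)))).
  rewrite /GRing.scale /= /g ?fctE /df; field.
  by rewrite !gt_eqF.
have df0 x : q <= x <= p -> 0 <= df x.
  move=> xqp; have [x0 x1] := bounds _ xqp; move: xqp => /andP[_ xp].
  apply: divr_ge0; first by rewrite mulr_ge0 ?sqr_ge0 ?subr_ge0.
  exact: mulr_ge0 (ltW x0) (ltW x1).
exact (@le_of_deriv_ge0 _ f df q p qp fE df0).
Qed.

(** The left-hand function is the integral over s in [0, 1] of
    (1 - s) / (1 + s (x - 1)), familiar from Bennett's inequality; this makes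
    the monotonicity plain.  The proof here differentiates, and the sign of
    the derivative is [ln_ge_ratio]. *)
Lemma bennett_antitone (R : realType) (x y : R) : 1 < x -> x <= y ->
  (y * ln y - (y - 1)) / (y - 1) ^+ 2 <= (x * ln x - (x - 1)) / (x - 1) ^+ 2.
Proof.
move=> x1 xy.
pose f : R -> R := (id - cst 1 - id * @ln R) * (fun z => ((id - cst 1) z)^-1)
   * (fun z => ((id - cst 1) z)^-1).
pose df (z : R) := ((z + 1) * ln z - 2 * (z - 1)) / (z - 1) ^+ 3.
have fE z : x <= z <= y -> is_derive z 1 f (df z).
  move=> /andP[xz _].
  have z0 : 0 < z by lra.
  have z1 : z - 1 != 0 by rewrite subr_eq0 gt_eqF // (lt_le_trans x1).
  have dln := is_derive1_ln z0.
  have d1 : is_derive z (1 : R) (id - cst 1 : R -> R) 1.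
    by apply: is_derive_eq; rewrite subr0.
  have dV := is_deriveV (z1 : (id - cst 1) z != 0) d1.
  have dN : is_derive z (1 : R) (id - cst 1 - id * @ln R) (- ln z).
    by apply: is_derive_eq; rewrite /GRing.scale /= ?fctE; field; lra.
  apply: (is_derive_eq (is_deriveM (is_deriveM dN dV) dV)).
  rewrite /GRing.scale /= ?fctE /df; field; lra.
have df0 z : x <= z <= y -> 0 <= df z.
  move=> /andP[xz _]; have z1 : 1 <= z by rewrite ltW // (lt_le_trans x1).
  apply: divr_ge0; last by rewrite exprn_ge0 ?subr_ge0.
  by rewrite subr_ge0 ln_ge_ratio.
have := @le_of_deriv_ge0 _ f df x y xy fE df0.
rewrite /f ?fctE /= => H; rewrite -lerN2.
by apply: (le_trans _ (le_trans H _)); rewrite le_eqVlt; apply/orP; left;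
  apply/eqP; field; lra.
Qed.

(** * The sharp exponential tilt *)

(** With x = 1 + theta / t the right-hand side is (t + eps) ln (1 + theta / t),
    the exponent gained by the tilt theta when the empirical process crosses at
    level t.  The derivative in x is (eps - theta * kappa x) / x, where kappa is
    the antitone function of [bennett_antitone]; so a critical point is a global
    minimum, although the exponent need not be convex in t. *)
Lemma crossing_exponent_min (R : realType) (theta eps x0 x : R) :
  0 < theta -> 1 < x0 -> 1 < x ->
  (x0 * ln x0 - (x0 - 1)) / (x0 - 1) ^+ 2 = eps / theta ->
  (theta / (x0 - 1) + eps) * ln x0 <= (theta / (x - 1) + eps) * ln x.
Proof.
move=> th0 x01 x1 crit.
pose h : R -> R := cst theta * (fun z => ((id - cst 1) z)^-1) + cst eps.
pose f : R -> R := h * @ln R.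
pose K (z : R) := (z * ln z - (z - 1)) / (z - 1) ^+ 2.
pose df (z : R) := (eps - theta * K z) / z.
have fE (z : R) : 1 < z -> is_derive z 1 f (df z).
  move=> z1'.
  have z0 : 0 < z by lra.
  have z1 : z - 1 != 0 by rewrite subr_eq0 gt_eqF.
  have dln := is_derive1_ln z0.
  have d1 : is_derive z (1 : R) (id - cst 1 : R -> R) 1.
    by apply: is_derive_eq; rewrite subr0.
  have dV := is_deriveV (z1 : (id - cst 1) z != 0) d1.
  apply: (is_derive_eq (is_deriveM (is_deriveD
    (is_deriveM (is_derive_cst theta z 1) dV)
    (is_derive_cst eps z 1)) dln)).
  rewrite /GRing.scale /= /h /df /K ?fctE /=; field; lra.
have Kx0 : eps = theta * K x0.
  by rewrite /K crit mulrC divfK // gt_eqF.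
have fval z : f z = (theta / (z - 1) + eps) * ln z by [].
rewrite -!fval.
have [x0x|/ltW xx0] := leP x0 x.
- have dfE z : x0 <= z <= x -> is_derive z 1 f (df z).
    by move=> /andP[xz _]; apply: fE; apply: lt_le_trans xz.
  have df0 z : x0 <= z <= x -> 0 <= df z.
    move=> /andP[xz _]; apply: divr_ge0; last by lra.
    rewrite Kx0 -mulrBr; apply: (mulr_ge0 (ltW th0)).
    by rewrite subr_ge0 bennett_antitone.
  exact (@le_of_deriv_ge0 _ f df _ _ x0x dfE df0).
- have dfE z : x <= z <= x0 -> is_derive z 1 (- f) (- df z).
    by move=> /andP[xz _]; apply: is_deriveN; apply: fE; apply: lt_le_trans xz.
  have df0 z : x <= z <= x0 -> 0 <= - df z.
    move=> /andP[xz zx0]; rewrite /df -mulNr; apply: divr_ge0; last by lra.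
    rewrite Kx0 opprB -mulrBr; apply: (mulr_ge0 (ltW th0)).
    by rewrite subr_ge0 bennett_antitone // (lt_le_trans x1).
  have := @le_of_deriv_ge0 _ (- f) (fun z => - df z) _ _ xx0 dfE df0.
  by rewrite !fctE lerN2.
Qed.

(** The equation says that q is a critical point of the relative entropy of a
    Bernoulli law of parameter q + eps with respect to one of parameter q, that
    is, a candidate for the level at which a crossing is the least unlikely. *)
Lemma relative_entropy_critical_point (R : realType) (eps : R) : 0 < eps < 1 ->
  exists q : R, [/\ 0 < q, q < 1 - eps &
    q * (1 - q) * (ln (q + eps) + ln (1 - q) - ln q - ln (1 - q - eps)) = eps].
Proof.
move=> /andP[e0 e1].
pose G (q : R) :=
  q * (1 - q) * (ln (q + eps) + ln (1 - q) - ln q - ln (1 - q - eps)).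
(* At a the two parameters are symmetric about 1 / 2 and G a <= eps reduces to
   [ln_le_half_diff]. *)
pose a : R := (1 - eps) / 2.
(* Near 1 - eps the term - ln (1 - q - eps) is unbounded; eta is small enough
   for this term to push G above eps. *)
pose eta : R := Num.min a (eps / expR (2 / (1 - eps))).
have a0 : 0 < a by rewrite /a; lra.
have eta0 : 0 < eta by rewrite lt_min a0 divr_gt0 // expR_gt0.
have etaa : eta <= a by rewrite ge_min lexx.
have etae : eta <= eps / expR (2 / (1 - eps)) by rewrite ge_min lexx orbT.
pose b : R := 1 - eps - eta.
have ab : a <= b by rewrite /b; move: etaa; rewrite /a; lra.
have be : b < 1 - eps by rewrite /b; lra.
have Gcont : {within `[a, b], continuous G}.
  apply: continuous_in_subspaceT => x.
  rewrite inE /= in_itv /= => /andP[ax xb].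
  have cid : {for x, continuous (fun z : R => z)} by exact: cvg_id.
  have c1 : {for x, continuous (fun z : R => 1 - z)}.
    by apply: cvgB; [exact: cvg_cst|exact: cvg_id].
  have lncont (g : R -> R) : {for x, continuous g} -> 0 < g x ->
      {for x, continuous (fun z => ln (g z))}.
    move=> gc g0; apply: (@continuous_comp _ _ _ g (@ln R)) => //.
    exact: continuous_ln.
  apply: cvgM; first by apply: cvgM.
  apply: cvgB; last first.
    by apply: lncont; [apply: cvgB => //; exact: cvg_cst|lra].
  apply: cvgB; last by apply: lncont => //; lra.
  apply: cvgD; last by apply: lncont => //; lra.
  by apply: lncont; [apply: cvgD => //; exact: cvg_cst|lra].
have Ga : G a <= eps.
  have e1' : 0 < 1 - eps by lra.
  pose r := (1 + eps) / (1 - eps).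
  have r1 : 1 <= r by rewrite /r ler_pdivlMr; lra.
  have -> : G a = a * (1 - a) * (2 * ln r).
    rewrite /G; congr (_ * _).
    have -> : a + eps = r * a by rewrite /r /a; field; lra.
    have -> : 1 - a = r * a by rewrite /r /a; field; lra.
    have -> : r * a - eps = a by rewrite /r /a; field; lra.
    rewrite lnM ?posrE //; [ring|lra].
  have aa : 0 <= a * (1 - a) by rewrite mulr_ge0 //; rewrite /a; lra.
  have := ln_le_half_diff r1 => lnr.
  have h : 2 * ln r <= r - r^-1 by lra.
  apply: le_trans (ler_wpM2l aa h) _.
  rewrite le_eqVlt; apply/orP; left; apply/eqP.
  rewrite /a /r; field; lra.
have Gb : eps <= G b.
  have b0 : 0 < b by lra.
  have b1 : 0 < 1 - b by rewrite /b; lra.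
  have E0 := expR_gt0 (2 / (1 - eps)).
  have e1' : 0 < 1 - eps by lra.
  have lnE : 2 / (1 - eps) <= ln (eps / eta).
    rewrite -[leLHS]expRK ler_ln ?posrE ?divr_gt0 //.
    by rewrite ler_pdivlMr // mulrC -ler_pdivlMr.
  rewrite ln_div ?posrE // in lnE.
  have l1 : ln b <= ln (b + eps) by rewrite ler_ln ?posrE; lra.
  have l2 : ln eps <= ln (1 - b) by rewrite ler_ln ?posrE // /b; lra.
  have <- : b * (1 - b) * (eps / (b * (1 - b))) = eps by field; lra.
  apply: ler_wpM2l; first exact: mulr_ge0 (ltW b0) (ltW b1).
  have -> : 1 - b - eps = eta by rewrite /b; ring.
  have : eps / (b * (1 - b)) <= 2 / (1 - eps).
    rewrite ler_pdivrMr ?mulr_gt0 // mulrAC ler_pdivlMr // mulrC.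
    have h1 : (1 - eps) / 2 <= b by [].
    have h2 : eps <= 1 - b by rewrite /b; lra.
    nra.
  lra.
have [|q qab Gq] := @IVT R G a b eps ab Gcont.
  by rewrite ge_min Ga /= le_max Gb orbT.
move: qab; rewrite in_itv /= => /andP[aq qb].
by exists q; split => //; lra.
Qed.

(** One tilt serves all levels: theta is the optimal Chernoff tilt for the
    critical level q of [relative_entropy_critical_point], and q is conversely
    the worst level for theta by [crossing_exponent_min].  At this saddle point
    the exponent is a relative entropy, at least 2 eps^2 by Pinsker. *)
Lemma sharp_tilt_exists (R : realType) (eps : R) : 0 < eps < 1 ->
  exists2 theta : R, 0 < theta & forall v, 0 < v ->
    ln (1 + theta) + 2 * eps ^+ 2 <= (theta / v + eps) * ln (1 + v).
Proof.
move=> eps01; have /andP[e0 e1] := eps01.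
have [q [q0 qe crit]] := relative_entropy_critical_point eps01.
pose p := q + eps.
have p0 : 0 < p by rewrite /p; lra.
have p1 : 0 < 1 - p by rewrite /p; lra.
have q1 : 0 < 1 - q by lra.
(* theta solves q + theta = p (1 + theta); x0 is 1 + theta / q. *)
pose theta := eps / (1 - p); pose x0 := p * (1 - q) / (q * (1 - p)).
have th0 : 0 < theta by rewrite divr_gt0.
have lnx0 : ln x0 = ln p + ln (1 - q) - ln q - ln (1 - p).
  rewrite /x0 ln_div ?posrE ?mulr_gt0 // !lnM ?posrE //; ring.
have lnth : ln (1 + theta) = ln (1 - q) - ln (1 - p).
  have -> : 1 + theta = (1 - q) / (1 - p).
    by rewrite /theta /p; field; rewrite gt_eqF.
  by rewrite ln_div ?posrE.
have lnx0E : ln x0 = eps / (q * (1 - q)).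
  rewrite -[in RHS]crit lnx0 /p opprD addrA; field.
  by rewrite !gt_eqF.
have x0B1 : x0 - 1 = eps / (q * (1 - p)).
  by rewrite /x0 /p; field; rewrite !gt_eqF.
have x01 : 1 < x0 by rewrite -subr_gt0 x0B1 divr_gt0 ?mulr_gt0.
exists theta => // v v0.
have v1 : 1 < 1 + v by lra.
have crit' : (x0 * ln x0 - (x0 - 1)) / (x0 - 1) ^+ 2 = eps / theta.
  rewrite lnx0E x0B1 /x0 /theta /p; field.
  by rewrite !gt_eqF.
have := crossing_exponent_min th0 x01 v1 crit'.
rewrite [1 + v - 1]addrAC subrr add0r; apply: le_trans.
have -> : theta / (x0 - 1) + eps = p.
  by rewrite x0B1 /theta /p; field; rewrite !gt_eqF.
have := @pinsker_bernoulli R p q q0 _ _; rewrite lnth lnx0 /p.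
have -> : q + eps - q = eps by ring.
rewrite lerDl -[q + eps < 1]subr_gt0 => H.
have {}H := H (ltW e0) p1; lra.
Qed.

(** The form in which the tilt enters the maximal inequality: raise
    [sharp_tilt_exists] to the power N, with v = theta / t.  Clearing the
    division by t lets the levels of probability zero be included. *)
Lemma sharp_tilt_pow_exists (R : realType) (N : nat) (eps : R) : 0 < eps < 1 ->
  exists2 theta : R, 0 < theta & forall (t : R) (l : nat), 0 <= t ->
    N%:R * (t + eps) <= l%:R ->
    expR (2 * N%:R * eps ^+ 2) * (1 + theta) ^+ N * t ^+ l <= (t + theta) ^+ l.
Proof.
move=> eps01; have [theta th0 H] := sharp_tilt_exists eps01.
have /andP[e0 _] := eps01.
exists theta => // t l; rewrite le_eqVlt => /predU1P[<-|t0] Nl.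
  case: l => [|l] in Nl *; last first.
    by rewrite expr0n mulr0 exprn_ge0 // add0r ltW.
  move: Nl; rewrite add0r pmulr_lle0 // => N0.
  have -> : N = 0%N by apply/eqP; rewrite -leqn0 -(ler_nat R).
  by rewrite !(mulr0n, mulr0, mul0r) expR0 !expr0 !mulr1.
have -> : (t + theta) ^+ l = (1 + theta / t) ^+ l * t ^+ l.
  by rewrite -exprMn; congr (_ ^+ _); field; rewrite gt_eqF.
apply: ler_wpM2r; first by rewrite exprn_ge0 // ltW.
have v0 : 0 < theta / t by rewrite divr_gt0.
have pow (x : R) (k : nat) : 0 < x -> x ^+ k = expR (k%:R * ln x).
  by move=> x0; rewrite expRM_natl lnK ?posrE.
rewrite (pow (1 + theta)) 1?(pow (1 + theta / t)); [|lra|lra].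
rewrite -expRD ler_expR.
have Hv := H _ v0.
have tE : theta / (theta / t) = t by field; rewrite !gt_eqF.
rewrite tE in Hv.
have lnv : 0 <= ln (1 + theta / t) by rewrite ln_ge0; lra.
have N0 : 0 <= N%:R :> R by [].
have h1 := ler_wpM2l N0 Hv.
have h2 := ler_wpM2r lnv Nl.
lra.
Qed.

(** * A maximal inequality along a chain of sets *)

Lemma sum_subsets_pow (R : comNzRingType) (I : finType) (S : {set I})
    (a b : R) :
  \sum_(A : {set I} | A \subset S) a ^+ #|A| * b ^+ #|S :\: A|
  = (a + b) ^+ #|S|.
Proof.
pose F i := if i \in S then a else 0.
pose G i := if i \in S then b else 1.
have -> : (a + b) ^+ #|S| = \prod_i (F i + G i).
  rewrite -prodr_const big_mkcond; apply: eq_bigr => i _.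
  by rewrite /F /G; case: ifP; rewrite ?add0r.
rewrite bigA_distr big_mkcond; apply: eq_bigr => A _.
case: ifPn => [AS|/subsetPn[i iA iS]]; last first.
  by rewrite (bigD1 i) //= iA /F (negbTE iS) mul0r.
rewrite -!prodr_const [X in X * _]big_mkcond [X in _ * X]big_mkcond -big_split.
apply: eq_bigr => i _; rewrite inE /F /G.
case: ifPn => [|_] /=; last by rewrite mul1r.
by move=> /(fintype.subsetP AS) ->; rewrite mulr1.
Qed.

Lemma outer_measure_bigsetU (T : Type) (R : realType)
    (mu : {outer_measure set T -> \bar R}) (I : Type) (r : seq I) (p : pred I)
    (F : I -> set T) :
  (mu (\big[setU/set0]_(i <- r | p i) F i) <= \sum_(i <- r | p i) mu (F i))%E.
Proof.
apply: (big_ind2 (fun A s => mu A <= s)%E) => //.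
  by rewrite outer_measure0.
move=> A s B u As Bu; apply: (le_trans (outer_measureU2 mu A B)).
exact: leeD.
Qed.

Section hitting.
Context (R : realType) (d : measure_display) (T : measurableType d)
  (P : probability T R) (n : nat) (Y : 'I_n -> {RV P >-> R})
  (hY : mutually_independent Y).

Definition count_in (y : 'I_n -> R) (S : {set 'I_n}) (C : set R) : nat :=
  #|[set i in S | `[< C (y i) >]]|.

Definition hits (I : eqType) (C : I -> set R) (b : I -> R) (s : seq I)
    (S : {set 'I_n}) (w : T) : Prop :=
  exists2 x, x \in s & b x <= (count_in (fun i => Y i w) S (C x))%:R.

(** Along a decreasing chain of sets C x of probability t x, the product over
    i in J of 1 + theta * 1_(Y i in C x) / t x is a martingale, namely the
    likelihood ratio obtained by adding a mass theta inside all the sets of the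
    chain.  This is Doob's maximal inequality for it, proved by induction on the
    chain: at each step S is split according to which of its members fall in the
    next set, and the tilted masses recombine by the binomial theorem
    (t x1 + theta) + (t x0 - t x1) = t x0 + theta.  The sets B record the cells
    of the observations already left behind, so that only the independence of
    rectangles is ever used. *)
Lemma hitting_bound (J : {set 'I_n}) (I : eqType) (r : rel I) (C : I -> set R)
    (t b : I -> R) (L theta : R) (s : seq I) :
  0 < L -> 0 <= theta -> transitive r -> (forall x, 0 <= t x) ->
  (forall x, measurable (C x)) -> (forall x y, r x y -> C y `<=` C x) ->
  (forall x i, i \in J -> P (Y i @^-1` C x) = (t x)%:E) ->
  (forall x l, b x <= l%:R -> L * t x ^+ l <= (t x + theta) ^+ l) ->
  forall x0, path r x0 s -> forall S : {set 'I_n}, S \subset J ->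
  forall B : 'I_n -> set R, (forall i, measurable (B i)) ->
  ((P^*)%mu ([set w | (forall i, i \in J :\: S -> B i (Y i w)) /\
                     (forall i, i \in S -> C x0 (Y i w)) /\ hits C b s S w])
   <= ((t x0 + theta) ^+ #|S| / L
       * \prod_(i in J :\: S) fine (P (Y i @^-1` B i)))%:E)%E.
Proof.
move=> L0 th0 rtr t0 mC rC Ct bC.
have prod_ge0 (K : {set 'I_n}) (B : 'I_n -> set R) :
    0 <= \prod_(i in K) fine (P (Y i @^-1` B i)).
  by apply: prodr_ge0 => i _; rewrite fine_ge0.
have mY i B : measurable B -> measurable (Y i @^-1` B).
  by move=> mB; rewrite -[X in measurable X]setTI; exact: measurable_funP.
elim: s => [|x1 s IH] x0 /= pth S SJ B mB.
  rewrite (_ : [set w | _] = set0) ?outer_measure0.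
    by rewrite lee_fin mulr_ge0 // divr_ge0 ?exprn_ge0 ?addr_ge0 // ltW.
  by apply/seteqP; split => w //= [_ [_ []]].
move: pth => /andP[r01 pth].
have hit_tail x : x \in s -> C x `<=` C x1.
  by move=> xs; apply: rC; have /allP/(_ x xs) := order_path_min rtr pth.
pose cell (A : {set 'I_n}) i := if i \in A then C x1 else
  if i \in S then C x0 `\` C x1 else B i.
have mcell A i : measurable (cell A i).
  by rewrite /cell; case: ifP => // _; case: ifP => // _; exact: measurableD.
pose E (A : {set 'I_n}) := if b x1 <= #|A|%:R then
    [set w | forall i, i \in J -> cell A i (Y i w)]
  else [set w | (forall i, i \in J :\: A -> cell A i (Y i w)) /\
                (forall i, i \in A -> C x1 (Y i w)) /\ hits C b s A w].
have cover : [set w | (forall i, i \in J :\: S -> B i (Y i w)) /\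
    (forall i, i \in S -> C x0 (Y i w)) /\ hits C b (x1 :: s) S w]
    `<=` \big[setU/set0]_(A : {set 'I_n} | A \subset S) E A.
  move=> w [/= wB [wC [x xs bx]]].
  pose A := [set i in S | `[< C x1 (Y i w) >]].
  have AS : A \subset S by apply/fintype.subsetP => i; rewrite inE => /andP[].
  rewrite (bigD1 A) //=; left.
  have wcell i : i \in J -> cell A i (Y i w).
    rewrite /cell inE => iJ.
    case: ifPn => [/andP[_ /asboolP]//|]; rewrite negb_and.
    case: ifPn => [iS /= /asboolPn nC|iS _]; first by split => //; exact: wC.
    by apply: wB; rewrite inE iS.
  rewrite /E; case: ifPn => [_ //|nbA] /=; split=> [i|].
    by rewrite inE => /andP[_]; exact: wcell.
  split=> [i|]; first by rewrite inE => /andP[_ /asboolP].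
  move: xs; rewrite inE => /predU1P[xx1|xs].
    by case/negP: nbA; move: bx; rewrite xx1.
  exists x => //; apply: (le_trans bx); rewrite ler_nat.
  apply/subset_leq_card/fintype.subsetP => i; rewrite !inE => /andP[iS iC].
  rewrite iS iC !andbT; apply/asboolP/(hit_tail _ xs); exact/asboolP.
apply: le_trans (le_mu_ext P cover) _.
apply: le_trans (outer_measure_bigsetU _ _ _ _) _.
have cellE (A : {set 'I_n}) : A \subset S ->
    \prod_(i in J :\: A) fine (P (Y i @^-1` cell A i)) =
    (t x0 - t x1) ^+ #|S :\: A| * \prod_(i in J :\: S) fine (P (Y i @^-1` B i)).
  move=> AS; rewrite (big_setID S) /=; congr (_ * _).
    rewrite -prodr_const; apply: eq_big => i; rewrite !inE.
      case: (boolP (i \in S)) => [/(fintype.subsetP SJ) ->|_];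
        last by rewrite !andbF.
      by rewrite !andbT.
    move=> /andP[/andP[iA iJ] iS]; rewrite /cell (negbTE iA) iS.
    have mC' x : measurable (Y i @^-1` C x) by exact: mY.
    have -> : Y i @^-1` (C x0 `\` C x1) = (Y i @^-1` C x0) `\` (Y i @^-1` C x1).
      by [].
    have sub : Y i @^-1` C x1 `<=` Y i @^-1` C x0 by move=> w; exact: rC.
    have fin0 : (P (Y i @^-1` C x0) < +oo)%E by rewrite Ct // ltry.
    have -> : P ((Y i @^-1` C x0) `\` (Y i @^-1` C x1)) =
        (t x0 - t x1)%:E.
      rewrite EFinB -(Ct x0 i iJ) -(Ct x1 i iJ) -[in RHS](setIidr sub).
      exact: measureD.
    by [].
  apply: eq_big => i; rewrite !inE.
    case: (boolP (i \in S)) => //= iS.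
    by rewrite (contra (fintype.subsetP AS i) iS).
  by move=> /and3P[iS iA _]; rewrite /cell (negbTE iA) (negbTE iS).
have PE (A : {set 'I_n}) : A \subset S -> ((P^*)%mu (E A) <=
    ((t x1 + theta) ^+ #|A| / L * ((t x0 - t x1) ^+ #|S :\: A| *
     \prod_(i in J :\: S) fine (P (Y i @^-1` B i))))%:E)%E.
  move=> AS; rewrite -cellE // /E; case: ifPn => [bA|_]; last first.
    exact: IH x1 pth A (fintype.subset_trans AS SJ) (cell A) (mcell A).
  have -> : [set w | forall i, i \in J -> cell A i (Y i w)] =
      \bigcap_(i in [set` J]) (Y i @^-1` cell A i) by [].
  have -> : ((P^*)%mu (\bigcap_(i in [set` J]) (Y i @^-1` cell A i)) =
      \prod_(i in J) P (Y i @^-1` cell A i))%E.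
    rewrite measurable_mu_extE; first by apply: hY => i _; exact: mcell.
    by apply: fin_bigcap_measurable => // i _; apply: mY; exact: mcell.
  rewrite (eq_bigr (fun i => (fine (P (Y i @^-1` cell A i)))%:E)); last first.
    by move=> i _; rewrite fineK // fin_num_measure //; apply: mY; exact: mcell.
  rewrite prodEFin lee_fin (big_setID A) /=.
  apply: ler_wpM2r; first exact: prod_ge0.
  rewrite ler_pdivlMr // mulrC; apply: le_trans (bC _ _ bA).
  apply: ler_wpM2l; first exact: ltW.
  rewrite le_eqVlt; apply/orP; left; apply/eqP.
  rewrite -prodr_const; apply: eq_big => i; rewrite !inE.
    have AJ := fintype.subsetP (fintype.subset_trans AS SJ).
    by case: (boolP (i \in A)) => [/AJ ->|_]; rewrite ?andbF.
  by move=> /andP[iJ iA]; rewrite /cell iA Ct.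
apply: le_trans (lee_sum _ PE) _.
have -> : t x0 + theta = (t x1 + theta) + (t x0 - t x1) by ring.
rewrite sumEFin lee_fin -sum_subsets_pow.
rewrite mulr_suml mulr_suml; apply: ler_sum => A _.
rewrite le_eqVlt; apply/orP; left; apply/eqP.
ring.
Qed.
End hitting.

(** * The one-sided Dvoretzky-Kiefer-Wolfowitz inequality *)

Section dkw.
Context (R : realType) (d : measure_display) (T : measurableType d)
  (P : probability T R) (n : nat) (Y : 'I_n -> {RV P >-> R})
  (hY : mutually_independent Y).

Lemma count_in_le (y : 'I_n -> R) (S : {set 'I_n}) C :
  (count_in y S C <= #|S|)%N.
Proof.
by apply/subset_leq_card/fintype.subsetP => i; rewrite inE => /andP[].
Qed.

Lemma measurable_count_gt (J : {set 'I_n}) (C : set R) (b : R) : measurable C ->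
  measurable [set w | b < (count_in (fun i => Y i w) J C)%:R].
Proof.
move=> mC.
rewrite (_ : [set w | _] =
  \big[setU/set0]_(A : {set 'I_n} | (A \subset J) && (b < #|A|%:R))
     \bigcap_(i in [set` A]) (Y i @^-1` C)); last first.
  apply/seteqP; split => w /=.
    move=> bw; pose A := [set i in J | `[< C (Y i w) >]].
    rewrite (bigD1 A) /=.
      by left => i /=; rewrite inE => /andP[_ /asboolP].
    by rewrite bw andbT; apply/fintype.subsetP => i; rewrite inE => /andP[].
  elim/big_ind: _ => // [X Z hX hZ [/hX|/hZ]//|A /andP[AJ bA] Aw].
  apply: lt_le_trans bA _; rewrite ler_nat.
  apply/subset_leq_card/fintype.subsetP => i iA.
  by rewrite inE (fintype.subsetP AJ i iA); apply/asboolP; exact: Aw.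
apply: bigsetU_measurable => A _; apply: fin_bigcap_measurable => // i _.
by rewrite -[X in measurable X]setTI; exact: measurable_funP.
Qed.

(** Both tails of the empirical process are instances: lower half-lines for
    the upper tail and upper half-lines for the lower one.  Finitely many levels
    are handled by [hitting_bound] after sorting, with the tilt of
    [sharp_tilt_pow_exists], and the countable case follows by continuity from
    below. *)
Lemma dkw_one_sided (J : {set 'I_n}) (I : eqType) (r : rel I) (C : I -> set R)
    (t : I -> R) (top : I) (e : nat -> I) (eps : R) :
  (0 < #|J|)%N -> 0 < eps -> transitive r -> total r ->
  (forall x, 0 <= t x) ->
  (forall x, measurable (C x)) -> (forall x y, r x y -> C y `<=` C x) ->
  (forall x i, i \in J -> P (Y i @^-1` C x) = (t x)%:E) ->
  C top = setT -> (forall x, r top x) ->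
  ((P^*)%mu [set w | exists k, (#|J|%:R * (t (e k) + eps)
       < (count_in (fun i => Y i w) J (C (e k)))%:R)%R]
   <= (expR (- (2 * #|J|%:R * eps ^+ 2)))%:E)%E.
Proof.
move=> J0 eps0 rtr rtot t0 mC rC Ct Ctop rtop.
set N : R := #|J|%:R.
pose D k := [set w | N * (t (e k) + eps)
  < (count_in (fun i => Y i w) J (C (e k)))%:R].
have mD k : measurable (D k) by exact: measurable_count_gt.
have [eps1|eps1] := leP 1 eps.
  (* For eps >= 1 a crossing would need more than #|J| points. *)
  rewrite (_ : [set w | _] = set0) ?outer_measure0 ?lee_fin ?expR_ge0 //.
  apply/seteqP; split => w //= [k]; apply/negP; rewrite -leNgt.
  have : (count_in (fun i => Y i w) J (C (e k)))%:R <= N.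
    by rewrite ler_nat count_in_le.
  move=> /le_trans; apply; rewrite ler_peMr // /N //.
  by rewrite -[leLHS]add0r lerD.
have eps01 : 0 < eps < 1 by rewrite eps0.
have [theta th0 tilt] := sharp_tilt_pow_exists #|J| eps01.
pose F K := \big[setU/set0]_(k < K) D k.
have tt : t top = 1.
  have [i iJ] := card_gt0P J0.
  have := Ct top i iJ; rewrite Ctop preimage_setT probability_setT.
  by case.
have PF K : (P (F K) <= (expR (- (2 * N * eps ^+ 2)))%:E)%E.
  pose s := sort r [seq e k | k <- iota 0 K].
  pose L := expR (2 * N * eps ^+ 2) * (1 + theta) ^+ #|J|.
  have L0 : 0 < L by rewrite mulr_gt0 ?expR_gt0 // exprn_gt0 // addr_gt0.
  have pth : path r top s.
    rewrite path_sortedE // sort_sorted // andbT.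
    by apply/allP => x _; exact: rtop.
  pose b x := N * (t x + eps).
  have bC x l : b x <= l%:R -> L * t x ^+ l <= (t x + theta) ^+ l.
    exact: tilt.
  have := hitting_bound hY L0 (ltW th0) rtr t0 mC rC Ct bC pth (fintype.subxx J)
    (B := fun=> setT) (fun=> measurableT).
  rewrite finset.setDv big_set0 mulr1 tt => H.
  rewrite -measurable_mu_extE; last exact: bigsetU_measurable.
  apply: le_trans (le_trans (le_mu_ext P _) H) _.
    move=> w; rewrite /F -bigcup_mkord => -[k /= kK Dk].
    split=> [i|]; first by rewrite inE.
    split=> [i|]; first by rewrite Ctop.
    exists (e k); last exact: ltW.
    by rewrite mem_sort map_f // mem_iota.
  rewrite lee_fin /L invfM mulrCA mulfV ?mulr1 ?expRN //.
  by rewrite expf_neq0 // gt_eqF // addr_gt0.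
have ndF : nondecreasing_seq F.
  by move=> k l kl; apply/subsetPset; exact: subset_bigsetU.
have DF : [set w | exists k, D k w] = \bigcup_K F K.
  apply/seteqP; split => w /=.
    by move=> [k Dk]; exists k.+1 => //; rewrite /F big_ord_recr; right.
  by move=> [K _]; rewrite /F -bigcup_mkord => -[k _ Dk]; exists k.
have mF K : measurable (F K) by exact: bigsetU_measurable.
have mUF : measurable (\bigcup_K F K) by exact: bigcup_measurable.
change ((P^*)%mu [set w | exists k, D k w]
  <= (expR (- (2 * N * eps ^+ 2)))%:E)%E.
rewrite DF measurable_mu_extE //.
have cv := @nondecreasing_cvg_mu _ T R P F mF mUF ndF.
rewrite -(cvg_lim _ cv) //; apply: lime_le; first exact: cvgP cv.
by near=> K; exact: PF.
Unshelve. all: by end_near. Qed.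
End dkw.

(** * From uniform deviations to the confidence region *)

(** Comparing the two clipped envelopes reduces to three families of real
    inequalities, one pair of indices at a time.  For kap = 0 the bound by kap
    is what makes the first quotient 0 or -oo. *)
Lemma clipped_max_le_clipped_min (R : realType) (n j : nat) (A B : nat -> R)
    (c kap : R) :
  0 <= kap ->
  (forall l, (l <= j)%N -> A l - c <= kap) ->
  (forall l, (j <= l <= n)%N -> 0 <= B l + c) ->
  (forall l l', (l <= j)%N -> (j <= l' <= n)%N -> A l - c <= B l' + c) ->
  (maxe 0 ((\big[maxe/-oo]_(0 <= l < j.+1) (A l)%:E - c%:E) / kap%:E) <=
   mine 1 ((\big[mine/+oo]_(j <= l < n.+1) (B l)%:E + c%:E) / kap%:E))%E.
Proof.
move=> kap0 Ak B0 AB.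
set X := (\big[maxe/-oo]_(0 <= l < j.+1) (A l)%:E)%E.
set Z := (\big[mine/+oo]_(j <= l < n.+1) (B l)%:E)%E.
have leX (v : \bar R) :
    (forall l, (l <= j)%N -> ((A l)%:E <= v)%E) -> (X <= v)%E.
  move=> H; rewrite /X big_nat_cond; apply: bigmax_le; first exact: leNye.
  by move=> l /andP[/andP[_ lj] _]; exact: H.
have leZ (v : \bar R) :
    (forall l, (j <= l <= n)%N -> (v <= (B l)%:E)%E) -> (v <= Z)%E.
  move=> H; rewrite /Z big_nat_cond; apply: le_bigmin; first exact: leey.
  by move=> l /andP[ljn _]; exact: H.
have kapV0 : (0 <= kap%:E^-1)%E.
  by rewrite inver; case: ifP; rewrite ?leey // lee_fin invr_ge0.
have kk : (kap%:E / kap%:E <= 1)%E.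
  rewrite inver; case: eqP => [->|/eqP nz]; first by rewrite mul0e lee01.
  by rewrite -EFinM divff.
have Xk : (X - c%:E <= kap%:E)%E.
  rewrite leeBlDr //; apply: leX => l lj.
  by rewrite -EFinD lee_fin -lerBlDr Ak.
have Z0 : (0 <= Z + c%:E)%E.
  rewrite -leeBlDr // sub0e; apply: leZ => l ljn.
  by rewrite -EFinN lee_fin; have := B0 _ ljn; lra.
have XZ : (X - c%:E <= Z + c%:E)%E.
  rewrite leeBlDr //; apply: leX => l lj.
  rewrite -leeBlDr // -leeBlDr //; apply: leZ => l' l'jn.
  by rewrite -!EFinB lee_fin; have := AB _ _ lj l'jn; lra.
rewrite ge_max !le_min lee01 mule_ge0 //= lee_wpmul2r // andbT.
exact: le_trans (lee_wpmul2r kapV0 Xk) kk.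
Qed.

Section counting.
Context (R : realType) (n : nat) (y : 'I_n -> R).

Lemma count_in_subset (S : {set 'I_n}) (C D : set R) :
  C `<=` D -> (count_in y S C <= count_in y S D)%N.
Proof.
move=> CD; apply/subset_leq_card/fintype.subsetP => i.
by rewrite !inE => /andP[-> /asboolP iC]; apply/asboolP; exact: CD.
Qed.

Lemma count_inC (S : {set 'I_n}) (C : set R) :
  (count_in y S C + count_in y (~: S) C = count_in y [set: 'I_n]%SET C)%N.
Proof.
rewrite /count_in -[RHS](cardsID S); congr (_ + _)%N;
  by apply: eq_card => i; rewrite !inE /= andbC.
Qed.

Let s := sort <=%R (codom y).

Let size_s : size s = n.
Proof. by rewrite size_sort size_codom card_ord. Qed.

Let sorted_s : sorted <=%R s.
Proof. by apply: sort_sorted; exact: le_total. Qed.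

Let count_s (p : pred R) : count p s = count_in y [set: 'I_n]%SET [set x | p x].
Proof.
have /permP -> : perm_eq s (codom y) by rewrite perm_sort.
rewrite codomE count_map /count_in cardE [in RHS]/enum_mem size_filter -enumT.
apply: eq_count => i /=.
by rewrite -[RHS]/(i \in finset _) !inE /=; apply/idP/asboolP.
Qed.

Lemma order_statP (l : nat) : (0 < l <= n)%N -> exists v : R,
  [/\ order_stat y l = v%:E,
      (l <= count_in y [set: 'I_n]%SET [set x | (x <= v)%R])%N &
      (count_in y [set: 'I_n]%SET [set x | (x < v)%R] < l)%N].
Proof.
case: l => // l /= ln; exists (nth 0 s l); split.
- by rewrite /order_stat /= (nth_map 0) // size_s.
- rewrite -count_s leqNgt; apply/negP; rewrite ltnS => h.
  have := @nth_count_gt _ _ (nth 0 s l) 0 s l sorted_s.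
  by rewrite size_s h ln ltxx => /(_ isT).
- rewrite -count_s ltnNge; apply/negP => h.
  by have := @nth_count_lt _ _ (nth 0 s l) 0 s l sorted_s h; rewrite ltxx.
Qed.

Lemma order_stat_top : order_stat y n.+1 = +oo%E.
Proof. by rewrite /order_stat nth_default //= size_map size_s. Qed.
End counting.

Section left_limit.
Context (R : realType) (F : cdfType R).

Lemma cdf_left_limP (r M : R) : (forall x, x < r -> F x <= M) ->
  cdf_left_at F r%:E <= M.
Proof.
move=> FM; apply: limr_le.
  apply: nondecreasing_at_left_is_cvgr.
    by near=> x => a b _ _; exact: cumulative_is_nondecreasing.
  near=> x; exists M => _ [z /= + <-]; rewrite in_itv /= => /andP[_ zr].
  exact: FM.
near=> x; apply: FM; near: x; exact: nbhs_left_lt.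
Unshelve. all: by end_near. Qed.
End left_limit.

(** Let h be the counting function of the observations outside J, which is
    nondecreasing with values between 0 and k.  All observations together number
    at least l up to Y_(l) and at most l below Y_(l+1), so that removing the
    controlled count over J bounds the lower envelope at l by h (Y_(l)) / n and
    the upper envelope at l from below by h (Y_(l+1)^-) / n.  The required
    inequalities follow from the monotonicity and the range of h. *)
Lemma confidence_region_of_count_bounds (R : realType) (n k : nat) (alpha : R)
    (y : 'I_n -> R) (J : {set 'I_n}) (F0 : cdfType R) :
  (k < n)%N -> #|J| = (n - k)%N ->
  (forall v, (count_in y J [set x | x <= v])%:R
     <= #|J|%:R * F0 v + n%:R * dkw_radius n k alpha) ->
  (forall v, #|J|%:R * cdf_left_at F0 v%:E - n%:R * dkw_radius n k alpha
     <= (count_in y J [set x | x < v])%:R) ->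
  confidence_region k alpha y F0.
Proof.
move=> kn cJ hup hlo j jn; rewrite /a_hat /b_hat.
have c0 : 0 <= dkw_radius n k alpha by exact: sqrtr_ge0.
set c := dkw_radius n k alpha in hup hlo c0 *.
have n0 : 0 < n%:R :> R by rewrite ltr0n (leq_ltn_trans _ kn).
have NE : #|J|%:R = n%:R - k%:R :> R by rewrite cJ natrB // ltnW.
set N : R := #|J|%:R in hup hlo NE.
have N0 : 0 <= N by rewrite /N.
have cC : (#|~: J| = k)%N.
  by have := cardsC J; rewrite card_ord cJ; lia.
have Ck C : (count_in y (~: J) C)%:R <= k%:R :> R.
  by rewrite ler_nat -cC count_in_le.
have split C : (count_in y [set: 'I_n]%SET C)%:R =
    (count_in y J C)%:R + (count_in y (~: J) C)%:R :> R.
  by rewrite -natrD count_inC.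
pose A l : R := l%:R / n%:R - (1 - k%:R / n%:R) * cdf_at F0 (order_stat y l).
pose B l : R :=
  l%:R / n%:R - (1 - k%:R / n%:R) * cdf_left_at F0 (order_stat y l.+1).
have nA l : n%:R * A l = l%:R - N * cdf_at F0 (order_stat y l).
  by rewrite /A NE; field; rewrite gt_eqF.
have nB l : n%:R * B l = l%:R - N * cdf_left_at F0 (order_stat y l.+1).
  by rewrite /B NE; field; rewrite gt_eqF.
have k0 : 0 <= k%:R :> R by [].
have nk : n%:R * (k%:R / n%:R) = k%:R :> R by field; rewrite gt_eqF.
have caseA l : (l <= j)%N ->
    l%:R - N * cdf_at F0 (order_stat y l) <= 0 \/
    exists v, order_stat y l = v%:E /\
      l%:R - N * cdf_at F0 (order_stat y l) - n%:R * c
        <= (count_in y (~: J) [set x | x <= v])%:R.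
  case: l => [|l] lj; first by left; rewrite /order_stat /= mulr0 subrr.
  right; have [|v [vE lv _]] := @order_statP R n y l.+1.
    by rewrite /= (leq_trans lj jn).
  exists v; split => //; rewrite vE /=.
  by have := hup v; move: lv; rewrite -(ler_nat R) split; lra.
have caseB l : (l <= n)%N ->
    (k%:R <= l%:R - N * cdf_left_at F0 (order_stat y l.+1)) \/
    exists v, order_stat y l.+1 = v%:E /\
      (count_in y (~: J) [set x | x < v])%:R <=
      l%:R - N * cdf_left_at F0 (order_stat y l.+1) + n%:R * c.
  rewrite leq_eqVlt => /predU1P[->|ln].
    by left; rewrite order_stat_top /= NE mulr1 opprB addrC subrK.
  right; have [|v [vE _ lv]] := @order_statP R n y l.+1; first by [].
  exists v; split => //; rewrite vE.
  by have := hlo v; move: lv; rewrite ltnS -(ler_nat R) split; lra.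
have nc0 : 0 <= n%:R * c by rewrite mulr_ge0 // ltW.
apply: (@clipped_max_le_clipped_min R n j A B c (k%:R / n%:R))
  => [|l lj|l /andP[jl ln]|l l' lj /andP[jl' l'n]].
- by rewrite divr_ge0.
- rewrite -(ler_pM2l n0); have eA := nA l.
  have [h|[v [_ h]]] := caseA l lj; first lra.
  by have := Ck [set x | x <= v]; lra.
- rewrite -(ler_pM2l n0); have eB := nB l.
  have [h|[v [_ h]]] := caseB l ln; first lra.
  have : 0 <= (count_in y (~: J) [set x | x < v])%:R :> R by [].
  lra.
- rewrite -(ler_pM2l n0); have eA := nA l; have eB := nB l'.
  have [h|[v [vE h]]] := caseA l lj; have [h'|[r [rE h']]] := caseB l' l'n.
  + lra.
  + have : 0 <= (count_in y (~: J) [set x | x < r])%:R :> R by [].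
    lra.
  + have := Ck [set x | x <= v]; lra.
  have [vr|rv] := ltP v r.
    have : (count_in y (~: J) [set x | x <= v])%:R <=
           (count_in y (~: J) [set x | x < r])%:R :> R.
      rewrite ler_nat count_in_subset // => x /= xv; exact: le_lt_trans vr.
    lra.
  (* Y_(l) = Y_(l'+1) although l <= l': h may jump there, and the envelopes are
     compared directly through F0 (v^-) <= F0 v. *)
  have ll' : l%:R <= l'%:R :> R by rewrite ler_nat (leq_trans lj).
  have Frv : cdf_left_at F0 (order_stat y l'.+1) <= cdf_at F0 (order_stat y l).
    rewrite rE vE; apply: cdf_left_limP => x xr.
    by apply: cumulative_is_nondecreasing; rewrite ltW // (lt_le_trans xr).
  have := ler_wpM2l N0 Frv; lra.
Qed.

(** * The two-sided inequality *)

Definition rat_enum (R : realType) (k : nat) : R :=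
  if unpickle k is Some q then ratr q else 0.

Lemma rat_enum_dense (R : realType) (a b : R) : a < b ->
  exists k, a < rat_enum R k < b.
Proof.
move=> ab; have [q] := rat_in_itvoo ab; rewrite in_itv /= => qab.
by exists (pickle q); rewrite /rat_enum pickleK.
Qed.

Section from_rationals.
Context (R : realType) (n : nat) (y : 'I_n -> R) (J : {set 'I_n})
  (F : cdfType R) (c : R).

(** Right-continuity of F allows v to be approached from above by rationals,
    along which the count can only be larger. *)
Lemma count_upper_of_rat :
  (forall k, (count_in y J [set x | x <= rat_enum R k])%:R
     <= #|J|%:R * F (rat_enum R k) + c) ->
  forall v, (count_in y J [set x | x <= v])%:R <= #|J|%:R * F v + c.
Proof.
move=> H v; apply/ler_addgt0Pr => eta eta0.
have N1 : 0 < #|J|%:R + 1 :> R by rewrite ltr_wpDl.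
have eta1 : 0 < eta / (#|J|%:R + 1) by rewrite divr_gt0.
have [d Fd] := nondecreasing_right_continuousP v F eta1.
have vd : v < v + d%:num by rewrite ltrDl.
have [k /andP[vk kd]] := rat_enum_dense vd.
have Fk : F (rat_enum R k) <= F v + eta / (#|J|%:R + 1).
  by apply: le_trans Fd; apply: cumulative_is_nondecreasing; exact: ltW.
have h1 : (count_in y J [set x | x <= v])%:R <=
    (count_in y J [set x | x <= rat_enum R k])%:R :> R.
  by rewrite ler_nat count_in_subset // => x /= /le_trans; apply; exact: ltW.
have h2 := ler_wpM2l (ler0n R #|J|) Fk.
have h3 : #|J|%:R * (eta / (#|J|%:R + 1)) <= eta.
  by rewrite mulrCA ler_piMr ?ltW // ltr_pdivrMr // mul1r ltrDl.
have := H k; lra.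
Qed.

(** Here v is approached from below, which produces the left limit of F and the
    strict inequality in the count. *)
Lemma count_lower_of_rat : (0 < #|J|)%N ->
  (forall k, #|J|%:R * F (rat_enum R k) - c
     <= (count_in y J [set x | x <= rat_enum R k])%:R) ->
  forall v,
    #|J|%:R * cdf_left_at F v%:E - c <= (count_in y J [set x | x < v])%:R.
Proof.
move=> J0 H v.
have N0 : 0 < #|J|%:R :> R by rewrite ltr0n.
rewrite lerBlDr mulrC -ler_pdivlMr //.
apply: cdf_left_limP => x xv; rewrite ler_pdivlMr // mulrC.
have [k /andP[xk kv]] := rat_enum_dense xv.
have Fk : F x <= F (rat_enum R k).
  by apply: cumulative_is_nondecreasing; exact: ltW.
have h1 : (count_in y J [set z | z <= rat_enum R k])%:R <=
    (count_in y J [set z | z < v])%:R :> R.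
  by rewrite ler_nat count_in_subset // => z /= zk; exact: le_lt_trans kv.
have := ler_wpM2l (ltW N0) Fk; have := H k; lra.
Qed.
End from_rationals.

Lemma count_in_setC (R : realType) (n : nat) (y : 'I_n -> R) (S : {set 'I_n})
    (C : set R) : (count_in y S C + count_in y S (~` C) = #|S|)%N.
Proof.
rewrite /count_in -[RHS](cardsID [set i | `[< C (y i) >]]%SET); congr (_ + _)%N;
  apply: eq_card => i; rewrite !inE //= andbC.
by congr (_ && _); apply/asboolP/asboolPn.
Qed.

Section dkw_two_sided.
Context (R : realType) (d : measure_display) (T : measurableType d)
  (P : probability T R) (n : nat) (Y : 'I_n -> {RV P >-> R})
  (hY : mutually_independent Y).

(** Union bound over the two tails.  The left limits are what the order
    statistics Y_(l+1) in the upper envelope of the region call for. *)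
Lemma dkw_two_sided (J : {set 'I_n}) (F : cdfType R) (eps : R) :
  (0 < #|J|)%N -> 0 < eps ->
  (forall i, i \in J -> forall x, cdf (Y i) x = (F x)%:E) ->
  ((P^*)%mu [set w | ~ ((forall v,
      ((count_in (fun i => Y i w) J [set x | (x <= v)%R])%:R
       <= #|J|%:R * (F v + eps))%R) /\
     (forall v, (#|J|%:R * (cdf_left_at F v%:E - eps) <=
      (count_in (fun i => Y i w) J [set x | (x < v)%R])%:R)%R))]
   <= (2 * expR (- (2 * #|J|%:R * eps ^+ 2)))%:E)%E.
Proof.
move=> J0 eps0 HF.
pose e k : \bar R := (rat_enum R k)%:E.
pose Cl (x : \bar R) : set R := [set z | (z%:E <= x)%E].
pose Cr (x : \bar R) : set R := [set z | (x < z%:E)%E].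
have CrE x : Cr x = ~` Cl x.
  by apply/seteqP; split => z /=; rewrite /Cr /Cl /= ltNge => /negP.
have mCl x : measurable (Cl x).
  case: x => [r||].
  - have -> : Cl r%:E = `]-oo, r]%classic by rewrite set_itvE.
    exact: measurable_itv.
  - have -> : Cl +oo%E = setT by apply/seteqP; split => z //= _; exact: leey.
    exact: measurableT.
  - have -> : Cl -oo%E = set0 by apply/seteqP; split => z.
    exact: measurable0.
have mCr x : measurable (Cr x) by rewrite CrE; exact: measurableC.
have PCl x i : i \in J -> P (Y i @^-1` Cl x) = (cdf_at F x)%:E.
  move=> iJ; case: x => [r||] /=.
  - rewrite -(HF _ iJ) /cdf /distribution /pushforward; congr (P _).
  - have -> : Cl +oo%E = setT by apply/seteqP; split => z //= _; exact: leey.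
    by rewrite preimage_setT probability_setT.
  - have -> : Cl -oo%E = set0 by apply/seteqP; split => z.
    by rewrite preimage_set0 measure0.
have PCr x i : i \in J -> P (Y i @^-1` Cr x) = (1 - cdf_at F x)%:E.
  move=> iJ; have mY : measurable (Y i @^-1` Cl x).
    by rewrite -[X in measurable X]setTI; exact: measurable_funP.
  by rewrite CrE preimage_setC probability_setC // PCl.
have [i0 i0J] := card_gt0P J0.
have F0 x : 0 <= cdf_at F x by rewrite -lee_fin -(PCl x _ i0J).
have F1 x : 0 <= 1 - cdf_at F x by rewrite -lee_fin -(PCr x _ i0J).
have ClT : Cl +oo%E = setT by apply/seteqP; split => z //= _; exact: leey.
have CrT : Cr -oo%E = setT by apply/seteqP; split => z //= _; exact: ltNyr.
have ClS (x z : \bar R) : (x >= z)%O -> Cl z `<=` Cl x.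
  by move=> zx u /= /le_trans; apply.
have CrS (x z : \bar R) : (x <= z)%O -> Cr z `<=` Cr x.
  by move=> xz u /=; exact: le_lt_trans.
have ge_total (x z : \bar R) : (x >= z)%O || (z >= x)%O by exact: le_total.
have up := dkw_one_sided hY e J0 eps0 ge_trans ge_total
  F0 mCl ClS PCl ClT (@leey R).
have lo := dkw_one_sided hY e J0 eps0 le_trans le_total
  F1 mCr CrS PCr CrT (@leNye R).
set b := expR _ in up lo *.
have -> : 2 * b = b + b by ring.
rewrite EFinD; apply: le_trans (leeD up lo).
apply: le_trans (outer_measureU2 _ _ _); apply: le_mu_ext => w /= bad.
have [|nup] := pselect (exists k, #|J|%:R * (cdf_at F (e k) + eps)
       < (count_in (fun i => Y i w) J (Cl (e k)))%:R); first by left.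
have [|nlo] := pselect (exists k, #|J|%:R * (1 - cdf_at F (e k) + eps)
       < (count_in (fun i => Y i w) J (Cr (e k)))%:R); first by right.
have ClE r : Cl r%:E = [set x | x <= r].
  by apply/seteqP; split => z; rewrite /Cl /= lee_fin.
case: bad; split => v.
- rewrite mulrDr; apply: count_upper_of_rat => k.
  rewrite -mulrDr -ClE leNgt; apply/negP => h; apply: nup; exists k; exact: h.
- rewrite mulrBr; apply: count_lower_of_rat => // k.
  rewrite -mulrBr -ClE leNgt; apply/negP => h; apply: nlo; exists k.
  have : (count_in (fun i => Y i w) J (Cl (e k)))%:R
    + (count_in (fun i => Y i w) J (Cr (e k)))%:R = #|J|%:R :> R.
    by rewrite CrE -natrD count_in_setC.
  move: h; rewrite -/(e k) /=; lra.
Qed.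
End dkw_two_sided.

(** * Level of the test *)

(** The radius is the (1 - alpha)-quantile bound of the two-sided inequality for
    n - k observations, rescaled by (n - k) / n. *)
Lemma dkw_radiusP (R : realType) (n k : nat) (alpha : R) :
  (k < n)%N -> 0 < alpha < 1 ->
  exists2 eps : R, 0 < eps &
    n%:R * dkw_radius n k alpha = (n - k)%:R * eps /\
    2 * expR (- (2 * (n - k)%:R * eps ^+ 2)) = alpha.
Proof.
move=> kn /andP[a0 a1].
have n0 : 0 < n%:R :> R by rewrite ltr0n (leq_ltn_trans _ kn).
have N0 : 0 < (n - k)%:R :> R by rewrite ltr0n subn_gt0.
have NE : (n - k)%:R = n%:R - k%:R :> R by rewrite natrB // ltnW.
have a2 : 0 < alpha / 2 by rewrite divr_gt0.
have ln0 : ln (alpha / 2) < 0 by rewrite ln_lt0 // a2 /=; lra.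
pose rad := - (1 - k%:R / n%:R) * ln (alpha / 2) / (2 * n%:R).
have radE : rad = (n - k)%:R * - ln (alpha / 2) / (2 * n%:R ^+ 2).
  by rewrite /rad NE; field; rewrite gt_eqF.
have rad0 : 0 < rad.
  by rewrite radE divr_gt0 ?mulr_gt0 ?oppr_gt0 ?exprn_gt0.
have c0 : 0 < dkw_radius n k alpha by rewrite sqrtr_gt0.
have c2 : dkw_radius n k alpha ^+ 2 = rad by rewrite sqr_sqrtr // ltW.
exists (n%:R * dkw_radius n k alpha / (n - k)%:R).
  by rewrite divr_gt0 ?mulr_gt0.
split; first by field; rewrite gt_eqF.
have -> : - (2 * (n - k)%:R * (n%:R * dkw_radius n k alpha / (n - k)%:R) ^+ 2) =
    ln (alpha / 2).
  by rewrite !exprMn c2 radE; field; rewrite !gt_eqF.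
by rewrite lnK ?posrE //; field.
Qed.

Lemma null_distributionsP (d : measure_display) (T : measurableType d)
    (R : realType) (P : probability T R) (n k : nat) (Y : 'I_n -> {RV P >-> R})
    (F : cdfType R) :
  null_distributions k Y F -> exists2 J : {set 'I_n}, #|J| = (n - k)%N &
    forall i, i \in J -> forall x, cdf (Y i) x = (F x)%:E.
Proof.
move=> /card_geqP[s [us ss sJ]]; exists [set i in s]%SET.
  by rewrite cardsE (card_uniqP us).
move=> i; rewrite inE => /sJ; rewrite inE => /= /asboolP; exact.
Qed.

(* The rejection event need not be measurable when Theta is uncountable, so its
   probability is bounded through the outer measure P^*, which coincides with P
   on measurable sets. *)
Theorem corollary6p3 (R : realType) (d : measure_display)
    (T : measurableType d) (P : probability T R)
    (n k : nat) (hk : (k < n)%N) (alpha : R) (halpha : 0 < alpha < 1)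
    (Y : 'I_n -> {RV P >-> R}) (hY : mutually_independent Y)
    (Theta : Type) (F0 : Theta -> cdfType R)
    (hnull : exists theta : Theta, null_distributions k Y (F0 theta)) :
  ((P^*)%mu [set w : T | forall theta : Theta,
     ~ confidence_region k alpha (fun i => Y i w) (F0 theta)]
   <= alpha%:E)%E.
Proof.
have [theta /null_distributionsP[J cJ HJ]] := hnull.
have [eps eps0 [nc bound]] := dkw_radiusP hk halpha.
have J0 : (0 < #|J|)%N by rewrite cJ subn_gt0.
rewrite -[X in (_ <= X%:E)%E]bound -cJ.
apply: le_trans (dkw_two_sided hY J0 eps0 HJ).
apply: le_mu_ext => w /= out [up lo]; apply: (out theta).
apply: (confidence_region_of_count_bounds hk cJ) => v; rewrite nc -cJ.
- by rewrite -mulrDr; exact: up.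
- by rewrite -mulrBr; exact: lo.
Qed.
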